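(* For all integers $p,q,r\ge 1$, the tree $T_{p,q,r}$ is $(2(p+q+r)+1)$-$\gamma_g$-critical; that is, $\gamma_g(T_{p,q,r}) = 2(p+q+r)+1$ and $\gamma_g(T_{p,q,r}|v) < \gamma_g(T_{p,q,r})$ for every vertex $v$ of $T_{p,q,r}$.
   Context: $T_{p,q,r}$ is the tree obtained from disjoint paths $P_{4p+1}$, $P_{4q+1}$, $P_{4r+1}$ (on $4p+1$, $4q+1$, $4r+1$ vertices) by identifying three end-vertices, one from each path. Domination game: Dominator and Staller alternately choose vertices, each chosen vertex must dominate at least one vertex not dominated by previously chosen vertices; the game ends when no such move exists; Dominator minimizes and Staller maximizes the number of moves. $\gamma_g(G)$ is the number of moves under optimal play when Dominator starts. For a vertex $v$, $G|v$ is $G$ with $v$ declared already dominated, and $\gamma_g(G|v)$ the number of moves under optimal play on it with Dominator starting. A graph $G$ is $\gamma_g$-critical if $\gamma_g(G|v)<\gamma_g(G)$ for every $v\in V(G)$, and $k$-$\gamma_g$-critical if moreover $\gamma_g(G)=k$. *)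

(* Defs.v *)
From HB Require Import structures.
From mathcomp Require Import all_boot.

Set Implicit Arguments.
Unset Strict Implicit.
Unset Printing Implicit Defensive.

Record sgraph := SGraph {
  vertex :> finType;
  adj : rel vertex;
  adj_sym : symmetric adj;
  adj_irrefl : irreflexive adj }.

Arguments adj {s}.

Definition cl_nbhd (G : sgraph) (v : G) : {set G} :=
  [set u | (u == v) || adj v u].

Inductive player := Dominator | Staller.

Definition opponent (s : player) : player :=
  if s is Dominator then Staller else Dominator.

Section DominationGame.

Variable G : sgraph.
Implicit Types (D : {set G}) (s : player) (v : G).

(* D is the set of vertices that are already dominated. *)
Definition legal D v : bool := ~~ (cl_nbhd v \subset D).

Definition play D v : {set G} := D :|: cl_nbhd v.

(* Minimax value of the position D with s to move. The argument n bounds the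
   number of moves explored; every move dominates a new vertex, so the bound
   #|~: D| used in game_length is never binding (see game_lengthE). *)
Fixpoint game_rec (n : nat) s D : nat :=
  if n is n'.+1 then
    if [pick v | legal D v] is Some v0 then
      let value v := game_rec n' (opponent s) (play D v) in
      (match s with
       | Dominator => \big[minn/value v0]_(v | legal D v) value v
       | Staller => \max_(v | legal D v) value v
       end).+1
    else 0
  else 0.

Definition game_length s D : nat := game_rec #|~: D| s D.

Lemma card_play D v : legal D v -> #|~: play D v| < #|~: D|.
Proof.
move=> /subsetPn[u uN uD]; apply/proper_card/properP; split.
  by rewrite setCS subsetUl.
by exists u; rewrite !inE ?uD // negb_or uD /= negbK; move: uN; rewrite inE.
Qed.

Lemma game_rec_stable n s D :
  #|~: D| <= n -> game_rec n s D = game_rec #|~: D| s D.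
Proof.
have [m] := ubnP n; elim: m n s D => // m IH n s D.
rewrite ltnS => le_nm le_Dn.
case: n le_nm le_Dn => [|n] le_nm le_Dn.
  by move: le_Dn; rewrite leqn0 => /eqP->.
case eD: #|~: D| le_Dn => [|k] le_kn /=.
  case: pickP => [v /card_play|//]; by rewrite eD.
case: pickP => [v0 Lv0|//].
have E v : legal D v -> game_rec n (opponent s) (play D v)
    = game_rec k (opponent s) (play D v).
  move=> /card_play; rewrite eD ltnS => le_k.
  have le_kn' : k <= n by rewrite -ltnS.
  rewrite IH ?(leq_trans le_k) // [RHS]IH //.
  exact: leq_ltn_trans le_kn' le_nm.
by case: s E => E; rewrite ?(E v0) // (eq_bigr _ E).
Qed.

Lemma game_lengthE s D :
  game_length s D =
    if [pick v | legal D v] is Some v0 then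
      let value v := game_length (opponent s) (play D v) in
      (match s with
       | Dominator => \big[minn/value v0]_(v | legal D v) value v
       | Staller => \max_(v | legal D v) value v
       end).+1
    else 0.
Proof.
rewrite {1}/game_length; case eD: #|~: D| => [|k] /=.
  case: pickP => [v /card_play|//]; by rewrite eD.
case: pickP => [v0 Lv0|//].
have E v : legal D v -> game_rec k (opponent s) (play D v)
    = game_length (opponent s) (play D v).
  by move=> /card_play; rewrite eD ltnS => /game_rec_stable ->.
by case: s E => E; rewrite ?(E v0) // (eq_bigr _ E).
Qed.

End DominationGame.

Definition gamma_g (G : sgraph) : nat := game_length Dominator (set0 : {set G}).

(* The number written gamma_g(G|v): v counts as dominated from the start, but
   it may still be chosen as a move. *)
Definition gamma_g_predom (G : sgraph) (v : G) : nat :=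
  game_length Dominator [set v].

Definition gamma_g_critical (G : sgraph) : Prop :=
  forall v : G, gamma_g_predom v < gamma_g G.

Definition k_gamma_g_critical (k : nat) (G : sgraph) : Prop :=
  gamma_g_critical G /\ gamma_g G = k.

Definition path_adj (n : nat) : rel 'I_n :=
  fun i j : 'I_n => (i.+1 == j) || (j.+1 == i).

Lemma path_adj_sym n : symmetric (@path_adj n).
Proof. by move=> i j; rewrite /path_adj /= orbC. Qed.

Lemma path_adj_irrefl n : irreflexive (@path_adj n).
Proof. by move=> i; rewrite /path_adj /= orbb gtn_eqF. Qed.

Definition path_graph (n : nat) : sgraph :=
  SGraph (@path_adj_sym n) (@path_adj_irrefl n).

Section Arms.

(* Placement of a path on k.+1 vertices in the glued graph: its end-vertex ord0
   goes to the common vertex None, the k others go into L by f. *)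
Variables (L : finType) (k : nat) (f : 'I_k -> L).

Definition arm (i : path_graph k.+1) : option L := omap f (unlift ord0 i).

Definition arm_adj : rel (option L) :=
  [rel x y | [exists i, [exists j, [&& adj i j, arm i == x & arm j == y]]]].

Lemma arm_adj_sym : symmetric arm_adj.
Proof.
have sub x y : arm_adj x y -> arm_adj y x.
  move=> /existsP[i /existsP[j /and3P[ij ix jy]]].
  by apply/existsP; exists j; apply/existsP; exists i; rewrite adj_sym ij ix jy.
by move=> x y; apply/idP/idP; apply: sub.
Qed.

Lemma arm_inj : injective f -> injective arm.
Proof.
move=> f_inj i j; rewrite /arm.
by case: unliftP => [i'|] ->; case: unliftP => [j'|] -> //= [/f_inj->].
Qed.

Lemma arm_adj_irrefl : injective f -> irreflexive arm_adj.
Proof.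
move=> f_inj x; apply/existsP=> -[i /existsP[j /and3P[ij /eqP ix /eqP jx]]].
have eq_ij : i = j by apply: arm_inj => //; rewrite ix jx.
by move: ij; rewrite eq_ij adj_irrefl.
Qed.

End Arms.

Section Tree.

Variables p q r : nat.

Definition tree_vertex : finType :=
  option ('I_(4 * p) + 'I_(4 * q) + 'I_(4 * r))%type.

Definition tree_adj : rel tree_vertex :=
  [rel x y | [|| arm_adj (inl \o inl) x y, arm_adj (inl \o inr) x y
               | arm_adj inr x y]].

Lemma tree_adj_sym : symmetric tree_adj.
Proof.
move=> x y; rewrite /tree_adj /=.
by congr [|| _, _ | _]; apply: arm_adj_sym.
Qed.

Lemma tree_adj_irrefl : irreflexive tree_adj.
Proof.
by move=> x; apply/or3P=> -[]; rewrite arm_adj_irrefl // => i j [].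
Qed.

(* T_{p,q,r}: its edges are the images of the edges of the three paths. *)
Definition tree : sgraph := SGraph tree_adj_sym tree_adj_irrefl.

End Tree.

(* Main.v *)
Require Import Defs.
From mathcomp Require Import all_boot zify.

(* Record each arm of the tree as the boolean word of its dominated vertices.

   Upper bounds: weigh a position by the sum, over the maximal runs of
   undominated vertices, of the length of the run, plus one if 4 does not divide
   it.  Dominator always has a move lowering this weight W by 3 (or by 2, if W
   is even), and by 4 if some run has length 3 modulo 4.  A move of Staller
   lowers W by at least 1 unless it creates a run of length 3 modulo 4.  Once
   the center is dominated, at most ceil(W/2) moves are left with Staller to
   play and at most W/2 with Dominator to play.  Playing the center first leaves
   W = 4(p+q+r).  With one vertex predominated, a first move chosen according to
   its distance from the center modulo 4 saves a move; when that distance is 1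
   modulo 4, Dominator leaves the center undominated at first and keeps the runs
   next to it at lengths divisible by 4.

   Lower bound: Staller dominates one new vertex at a time, whereas Dominator
   can dominate three, and four once, with the center.  This count would leave
   exactly one move too few, so Staller forces Dominator to waste a vertex: she
   keeps the number of undominated vertices of each arm divisible by 4 until the
   center is played, and from then on keeps the sum of the residues modulo 4 of
   these three numbers at least 5. *)

Set Implicit Arguments.
Unset Strict Implicit.
Unset Printing Implicit Defensive.

(** * Bounding the game length one move at a time *)

Section GameBounds.

Variable G : sgraph.
Implicit Types (D : {set G}) (v : G).

Lemma legal_playP D v : reflect (play D v <> D) (legal D v).
Proof.
apply: (iffP idP) => [/subsetPn[u uN uD] E|E].
  by move: uD; rewrite -E inE uN orbT.
by apply/negP => /setUidPl.
Qed.

Lemma staller_ge D v m :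
  legal D v -> m <= game_length Dominator (play D v) ->
  m < game_length Staller D.
Proof.
move=> Lv le_m; rewrite game_lengthE; case: pickP => [v0 _|/(_ v)];
  last by rewrite Lv.
by rewrite ltnS; apply: leq_trans le_m _; exact: (leq_bigmax_cond _ Lv).
Qed.

Lemma staller_le D m :
  (forall v, legal D v -> game_length Dominator (play D v) < m) ->
  game_length Staller D <= m.
Proof.
move=> le_m; rewrite game_lengthE; case: pickP => [v0 Lv0|//].
case: m le_m => [/(_ _ Lv0)//|m le_m]; rewrite ltnS.
by apply/bigmax_leqP => v /le_m.
Qed.

Lemma dominator_le D v m :
  legal D v -> game_length Staller (play D v) <= m ->
  game_length Dominator D <= m.+1.
Proof.
move=> Lv le_m; rewrite game_lengthE; case: pickP => [v0 _|//].
rewrite ltnS; apply: leq_trans le_m.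
(* The iterated minimum starts from an arbitrary default value, not from a neutral element, so it is
   bounded by induction along the enumeration. *)
have: v \in index_enum G by rewrite mem_index_enum.
elim: (index_enum _) => // u s IH; rewrite inE big_cons => /predU1P[<-|/IH le_v].
  by rewrite Lv geq_minl.
by case: ifP => // _; apply: leq_trans le_v; exact: geq_minr.
Qed.

Lemma dominator_ge D v0 m :
  legal D v0 ->
  (forall v, legal D v -> m <= game_length Staller (play D v)) ->
  m < game_length Dominator D.
Proof.
move=> L0 le_m; rewrite game_lengthE; case: pickP => [v1 L1|/(_ v0)];
  last by rewrite L0.
rewrite ltnS; apply: (big_ind (fun x => m <= x)) => //; first exact: le_m.
by move=> x y; rewrite leq_min => -> ->.
Qed.

End GameBounds.

(** * Moves as operations on words *)

Definition mark_head (w : seq bool) : seq bool :=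
  if w is _ :: w' then true :: w' else [::].

(** The effect of a move on the word of its own arm; [mark_head] is the effect of a move at the
    center. *)
Fixpoint mark (i : nat) (w : seq bool) : seq bool :=
  match w, i with
  | [::], _ => [::]
  | _ :: w', 0 => true :: mark_head w'
  | a :: w', i'.+1 => (a || (i' == 0)) :: mark i' w'
  end.

Lemma size_mark_head w : size (mark_head w) = size w.
Proof. by case: w. Qed.

Lemma size_mark i w : size (mark i w) = size w.
Proof. by elim: w i => [|a w IH] [|i] //=; rewrite ?IH ?size_mark_head. Qed.

Lemma nth_mark_head w j : nth true (mark_head w) j = nth true w j || (j == 0).
Proof. by case: w j => [|a w] [|j] //=; rewrite ?orbF ?orbT ?nth_nil. Qed.

(** The default letter [true] treats positions past the end of the arm as dominated, which spares
    any bound on [j]. *)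
Lemma nth_mark i w j :
  nth true (mark i w) j = nth true w j || ((j <= i.+1) && (i <= j.+1)).
Proof.
elim: w i j => [|a w IH] [|i] [|j] //=; rewrite ?nth_nil ?orbT //.
  by rewrite nth_mark_head andbT ltnS leqn0.
  by rewrite ltnS leqn0.
exact: IH.

Qed.

(** * Weight of a word and its change under a move *)

Definition run_weight (n : nat) := (n %% 4 != 0) + n.

Definition is_run3 (n : nat) : nat := n %% 4 == 3.

Arguments run_weight : simpl never.
Arguments is_run3 : simpl never.

Lemma run_values : [/\ run_weight 0 = 0, run_weight 1 = 2, is_run3 0 = 0
  & is_run3 1 = 0].
Proof. by []. Qed.

(** In this lemma and the next two, a run loses one or two vertices at an end, or three consecutive
    ones anywhere. The potential, twice the weight minus the number of runs of length 3 modulo 4,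
    drops each time; so the weight can stay put only if a new such run appears. *)
Lemma run_potential1 n : run_weight n <= run_weight n.+1
  /\ 2 * run_weight n + is_run3 n.+1 + 1 <= is_run3 n + 2 * run_weight n.+1.
Proof. by rewrite /run_weight /is_run3; lia. Qed.

Lemma run_potential2 n : run_weight n <= run_weight n.+2
  /\ 2 * run_weight n + is_run3 n.+2 + 1 <= is_run3 n + 2 * run_weight n.+2.
Proof. by rewrite /run_weight /is_run3; lia. Qed.

Lemma run_potential3 n m : run_weight n + run_weight m <= run_weight (n + m).+3
  /\ 2 * (run_weight n + run_weight m) + is_run3 (n + m).+3 + 1
     <= is_run3 n + is_run3 m + 2 * run_weight (n + m).+3.
Proof. by rewrite /run_weight /is_run3; lia. Qed.

(* In [weight], [runs3] and their lemmas, [n] undominated vertices precede [w]. *)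
Fixpoint weight (n : nat) (w : seq bool) : nat :=
  match w with
  | [::] => run_weight n
  | true :: w' => run_weight n + weight 0 w'
  | false :: w' => weight n.+1 w'
  end.

Fixpoint runs3 (n : nat) (w : seq bool) : nat :=
  match w with
  | [::] => is_run3 n
  | true :: w' => is_run3 n + runs3 0 w'
  | false :: w' => runs3 n.+1 w'
  end.

Definition lead (w : seq bool) : nat := find id w.

(** A prefix of [n] undominated vertices only lengthens the first run; [R] and [C] collect the later
    runs. Changes of weight thus reduce to arithmetic on [run_weight] and [is_run3]. *)
Lemma lead_split w : exists R C : nat, forall n : nat,
  weight n w = run_weight (n + lead w) + R
  /\ runs3 n w = is_run3 (n + lead w) + C.
Proof.
elim: w => [|[] w IH] /=.
- by exists 0, 0 => n; rewrite !addn0.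
- by exists (weight 0 w), (runs3 0 w) => n; rewrite addn0.
case: IH => R [C E]; exists R, C => n.
by have [-> ->] := E n.+1; rewrite addSnnS.
Qed.

(* A move at the first letter does not reach back, hence [n = 0] in that case. *)
Lemma mark_weight n i w : (i = 0 -> n = 0) ->
  mark i w = w \/
  weight n (mark i w) <= weight n w
  /\ 2 * weight n (mark i w) + runs3 n w + 1
     <= runs3 n (mark i w) + 2 * weight n w.
Proof.
have [rw0 rw1 r0 r1] := run_values.
elim: w n i => [|a w IH] n i ni; first by left; case: i {ni}.
case: i ni => [|[|i]] ni.
- rewrite (ni erefl) {ni n}; case: w {IH} => [|b w].
    by case: a; [left|right].
  have [R [C E]] := lead_split w.
  have := run_potential1 (lead w); have := run_potential2 (lead w).
  by case: a b => [] []; [by left| | |]; right => /=;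
    rewrite ?(E _).1 ?(E _).2 ?add0n ?add1n ?add2n; lia.
- have := run_potential1 n; have := run_potential2 n.
  case: w {IH} => [|b [|c w]].
  + by case: a; [left|right => /=; lia].
  + by case: a b => [] []; [by left| | |]; right => /=; lia.
  have [R [C E]] := lead_split w.
  have := run_potential1 (lead w); have := run_potential2 (lead w).
  have := run_potential3 n (lead w).
  by case: a b c => [] [] []; [by left| | | | | | |]; right => /=;
    rewrite ?(E _).1 ?(E _).2 ?add0n ?add1n ?add2n ?addSn; lia.
have -> : mark i.+2 (a :: w) = a :: mark i.+1 w by rewrite /= orbF.
case: a => /=.
  by case: (IH 0 i.+1) => //= [->|]; [left|right; lia].
by case: (IH n.+1 i.+1) => //= [->|]; [left|right; lia].
Qed.

Lemma mark_head_weight w :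
  mark_head w = w \/
  weight 0 (mark_head w) <= weight 0 w
  /\ 2 * weight 0 (mark_head w) + runs3 0 w + 1
     <= runs3 0 (mark_head w) + 2 * weight 0 w.
Proof.
case: w => [|[] w]; [by left|by left|right].
have [rw0 _ r0 _] := run_values.
have [R [C E]] := lead_split w; have := run_potential1 (lead w).
by rewrite /= !(E _).1 !(E _).2 !add0n add1n; lia.
Qed.

Lemma weight_falses n k w : weight n (nseq k false ++ w) = weight (n + k) w.
Proof. by elim: k n => [|k IH] n; rewrite ?addn0 //= IH addSnnS. Qed.

Lemma runs3_falses n k w : runs3 n (nseq k false ++ w) = runs3 (n + k) w.
Proof. by elim: k n => [|k IH] n; rewrite ?addn0 //= IH addSnnS. Qed.

Lemma lead_falses k w : lead (nseq k false ++ w) = k + lead w.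
Proof. by rewrite /lead; elim: k => //= k ->. Qed.

Lemma weight_run m w :
  weight 0 (nseq m false ++ true :: w) = run_weight m + weight 0 w.
Proof. exact: weight_falses. Qed.

Lemma runs3_run m w :
  runs3 0 (nseq m false ++ true :: w) = (m %% 4 == 3) + runs3 0 w.
Proof. exact: runs3_falses. Qed.

Lemma lead_run m w : lead (nseq m false ++ true :: w) = m.
Proof. by rewrite lead_falses addn0. Qed.

Lemma weight_nseq m : weight 0 (nseq m false) = run_weight m.
Proof. by rewrite -[nseq _ _]cats0 weight_falses. Qed.

Lemma runs3_nseq m : runs3 0 (nseq m false) = (m %% 4 == 3).
Proof. by rewrite -[nseq _ _]cats0 runs3_falses. Qed.

Lemma lead_nseq m : lead (nseq m false) = m.
Proof. by rewrite -[nseq _ _]cats0 lead_falses addn0. Qed.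

Lemma mark_run m i w :
  mark (m.+1 + i) (nseq m false ++ true :: w) = nseq m false ++ true :: mark i w.
Proof. by elim: m => //= m ->. Qed.

(** * Replies of Dominator on a single arm *)

Lemma word_run w :
  w = nseq (size w) false \/ exists m v, w = nseq m false ++ true :: v.
Proof.
elim: w => [|[] w IH]; first by left.
  by right; exists 0, w.
case: IH => [E|[m [v ->]]]; first by left; rewrite /= -E.
by right; exists m.+1, v.
Qed.

(* The last conjunct keeps the move away from a run next to the center. *)
Lemma reply_run3 w : 0 < runs3 0 w ->
  exists i, [/\ i < size w, weight 0 (mark i w) + 4 <= weight 0 w,
    runs3 0 w <= (runs3 0 (mark i w)).+1
    & lead w %% 4 != 3 -> 0 < i /\ lead (mark i w) = lead w].
Proof.
have [k] := ubnP (size w); elim: k w => // k IH w; rewrite ltnS => le_wk c3.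
have [L3|L3] := eqVneq (lead w %% 4) 3.
  (* The second vertex of the run dominates its first three, leaving a length divisible by 4: the
     run and its extra unit lose 4 together. *)
  exists 1; case: w le_wk c3 L3 => [|[] [|[] [|[] w]]] //= _ _ L3.
  have [R [C E]] := lead_split w; rewrite !(E _).1 !(E _).2 /run_weight /is_run3.
  by move: L3; rewrite /lead /= -/(lead w) => L3; split; lia.
have [E|[m [v E]]] := word_run w.
  have L : lead w = size w by rewrite {1}E lead_nseq.
  by move: c3; rewrite E runs3_nseq -L (negPf L3).
move: c3 L3 le_wk; rewrite E runs3_run lead_run weight_run size_cat size_nseq /=.
move=> c3 L3 le_k; rewrite (negPf L3) add0n in c3 *.
have [||i [i_lt W C _]] := IH v; [lia|by []|].
exists (m.+1 + i); rewrite mark_run weight_run runs3_run lead_run (negPf L3).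
by split=> [||| _]; lia.
Qed.

(** A run has odd weight only if its length is 2 modulo 4. Playing the first vertex of such a run
    dominates two of its vertices and also removes the extra unit. *)
Lemma reply_odd w : odd (weight 0 w) ->
  exists i, [/\ i < size w, weight 0 (mark i w) + 3 <= weight 0 w
    & lead w %% 4 != 2 -> 0 < i /\ lead (mark i w) = lead w].
Proof.
have [k] := ubnP (size w); elim: k w => // k IH w; rewrite ltnS => le_wk oW.
have [L2|L2] := eqVneq (lead w %% 4) 2.
  exists 0; case: w le_wk oW L2 => [|[] [|[] w]] //= _ _ L2.
  have [R [C E]] := lead_split w; rewrite !(E _).1 /run_weight.
  by move: L2; rewrite /lead /= -/(lead w) => L2; split; lia.
have [E|[m [v E]]] := word_run w.
  have L : lead w = size w by rewrite {1}E lead_nseq.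
  by move: oW; rewrite E weight_nseq -L /run_weight; lia.
move: oW L2 le_wk; rewrite E lead_run weight_run size_cat size_nseq /=.
move=> oW L2 le_k.
have [||i [i_lt W _]] := IH v; [lia| |].
  by move: oW; rewrite /run_weight; lia.
by exists (m.+1 + i); rewrite mark_run weight_run lead_run; split=> [|| _]; lia.
Qed.

Lemma reply_any w : 0 < weight 0 w ->
  exists i, i < size w /\ weight 0 (mark i w) + 2 <= weight 0 w.
Proof.
elim: w => [//|[] w IH] /=.
  by rewrite add0n => /IH[i [i_lt W]]; exists i.+1; rewrite /= add0n.
move=> _; case: w {IH} => [|[] w]; first by exists 0.
  by exists 0 => /=; rewrite addnC.
case: w => [|[] w]; [by exists 0 | by exists 0 => /=; rewrite /run_weight; lia |].
(* Removing three vertices gains only 2 when the length is divisible by 4, since the rest then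
   acquires the extra unit. *)
exists 1; have [R [C E]] := lead_split w.
by rewrite /= !(E _).1 /run_weight; lia.
Qed.

(** The move reaches back to position [i.-1], so it can alter the first run only by cutting it
    there; [y] is what follows the cut. *)
Lemma lead_mark i w : 0 < i -> lead (mark i w) != lead w ->
  lead (mark i w) = i.-1 /\ exists y,
    w = nseq i.-1 false ++ false :: y
    /\ mark i w = nseq i.-1 false ++ true :: mark 0 y.
Proof.
elim: w i => [|a w IH] [|[|i]] // _.
  case: a => //; rewrite /lead /=.
  by move=> _; split=> //; exists w.
case: a => //.
have -> : mark i.+2 (false :: w) = false :: mark i.+1 w by [].
rewrite /lead /= -!/(lead _) eqSS => /(IH i.+1 isT)[/= E [y [E1 E2]]].
by split; [rewrite E | exists y; rewrite {1}E1 E2].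
Qed.

Lemma mark_nseq a i w :
  mark (a + i.+1) (nseq a false ++ w) = nseq a false ++ mark i.+1 w.
Proof. by elim: a => //= a ->; rewrite addnS. Qed.

(* Staller breaks a leading run of length divisible by 4; cutting the remainder
   modulo 4 off what is left of it restores divisibility. *)
Lemma restore_lead i w : 0 < i -> lead w %% 4 = 0 ->
  lead (mark i w) %% 4 != 0 ->
  exists j, [/\ 0 < j, j < size w, lead (mark j (mark i w)) %% 4 = 0
    & weight 0 (mark j (mark i w)) + 4 <= weight 0 w].
Proof.
move=> i_gt0 L L'.
have /(lead_mark i_gt0)[E [y [Ew Em]]] : lead (mark i w) != lead w.
  by apply: contraNneq L' => ->; rewrite L.
move: i.-1 E Ew Em => m E Ew Em; rewrite E in L'.
(* [a] is the target length and [s], between 1 and 3, the surplus. A move at [a + 1] covers [a] to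
   [a + 2], hence the whole surplus. *)
pose a := m - m %% 4; pose s := m %% 4.
have m_as : m = a + s by rewrite /a /s; lia.
have s_lt : s < 4 by rewrite /s; lia.
exists (a + 1).
have Ej : mark (a + 1) (mark i w)
    = nseq a false ++ true :: nseq s true ++ mark 0 y.
  rewrite Em m_as nseqD -catA mark_nseq; congr (_ ++ _).
  case: s s_lt {m_as} (L' : s != 0) => [|[|[|[|]]]] //= _ _.
  by case: y {Ew Em}.
have W1 : weight 0 (nseq s true ++ mark 0 y) = weight 0 (mark 0 y).
  by elim: (s).
have Ww : weight 0 w = weight m.+1 y by rewrite Ew weight_falses.
have Lw : lead w = m.+1 + lead y by rewrite Ew lead_falses addnS.
have sz : m < size w by rewrite Ew size_cat size_nseq /=; lia.
rewrite Ej lead_run weight_run W1 Ww; rewrite Lw in L.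
split; [lia|lia|lia|].
(* The cases are whether [mark 0] dominates none, one or two of the vertices that the old leading
   run still has in [y]. *)
case: y L {Ew Em Ej W1 Ww Lw} => [|[] y]; rewrite /lead /= -?/(lead _).
- by rewrite /run_weight; lia.
- by case: (mark_head_weight y) => [->|]; rewrite /run_weight; lia.
case: y => [|[] y]; rewrite /lead /= -?/(lead _).
- by rewrite /run_weight; lia.
- by rewrite /run_weight; lia.
by have [R [C E0]] := lead_split y; rewrite !(E0 _).1 /run_weight; lia.
Qed.

(** * Adjacency along the arms *)

Section ArmAdjacency.

Variables (L : finType) (k : nat) (f : 'I_k -> L).
Hypothesis f_inj : injective f.

Lemma arm_adj_arm i j : arm_adj f (arm f i) (arm f j) = path_adj i j.
Proof.
apply/existsP/idP => [[i' /existsP[j' /and3P[ij]]]|ij].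
  by move=> /eqP/(arm_inj f_inj)<- /eqP/(arm_inj f_inj)<-.
by exists i; apply/existsP; exists j; rewrite !eqxx !andbT.
Qed.

Lemma arm_center : arm f ord0 = None.
Proof. by rewrite /arm unlift_none. Qed.

Lemma arm_lift i : arm f (lift ord0 i) = Some (f i).
Proof. by rewrite /arm liftK. Qed.

Lemma arm_adjSS i j :
  arm_adj f (Some (f i)) (Some (f j)) = (i.+1 == j) || (j.+1 == i).
Proof. by rewrite -!arm_lift arm_adj_arm. Qed.

Lemma arm_adjNS j : arm_adj f None (Some (f j)) = (j == 0 :> nat).
Proof.
by rewrite -arm_center -arm_lift arm_adj_arm /path_adj /= orbF eqSS eq_sym.
Qed.

Lemma arm_adj_out a y : (forall i, f i != a) -> arm_adj f (Some a) y = false.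
Proof.
move=> fa; apply/existsP => -[i /existsP[j /and3P[_ /eqP + _]]].
case: (unliftP ord0 i) => [i'|] ->; rewrite ?arm_center // arm_lift => -[/eqP].
by rewrite (negPf (fa _)).
Qed.

Lemma arm_adj_outSS a b : (forall i, f i != a) \/ (forall i, f i != b) ->
  arm_adj f (Some a) (Some b) = false.
Proof. by case=> ?; [|rewrite arm_adj_sym]; apply: arm_adj_out. Qed.

End ArmAdjacency.

Lemma insub_ord n i (lt_i : i < n) : insub i = Some (Ordinal lt_i).
Proof. exact: insubT. Qed.

(** * Positions as three words and the state of the center *)

Section Spider.

Variables p q r : nat.

Local Notation T := (tree p q r).

Definition center : T := None.

Definition len (k : 'I_3) : nat :=
  4 * match val k with 0 => p | 1 => q | _ => r end.

(* Index 0 is the neighbour of the center; out of range, [vx] is [center]. *)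
Definition vx (k : 'I_3) (i : nat) : T :=
  match val k with
  | 0 => omap (inl \o inl) (insub i : option 'I_(4 * p))
  | 1 => omap (inl \o inr) (insub i : option 'I_(4 * q))
  | _ => omap inr (insub i : option 'I_(4 * r))
  end.

Lemma vxP (x : T) : x = center \/ exists k i, i < len k /\ x = vx k i.
Proof.
case: x => [[[i|i]|i]|]; last by left.
- by right; exists (Ordinal (isT : 0 < 3)), i; rewrite /vx /= valK.
- by right; exists (Ordinal (isT : 1 < 3)), i; rewrite /vx /= valK.
- by right; exists (Ordinal (isT : 2 < 3)), i; rewrite /vx /= valK.
Qed.

Lemma cl_refl (x : T) : x \in cl_nbhd x.
Proof. by rewrite inE eqxx. Qed.

Lemma cl_sym (x y : T) : (x \in cl_nbhd y) = (y \in cl_nbhd x).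
Proof. by rewrite !inE eq_sym adj_sym. Qed.

Lemma cl_center_vx k i : i < len k -> (vx k i \in cl_nbhd center) = (i == 0).
Proof.
case: k => [[|[|[|//]]] Hk]; rewrite /len /vx /= => lt_i;
  rewrite insub_ord inE /= /tree_adj /= ![arm_adj _ None _]arm_adj_sym.
- rewrite (arm_adj_out (f := inl \o inr)) // (arm_adj_out (f := inr)) // !orbF.
  by rewrite arm_adj_sym (arm_adjNS (f := inl \o inl)) // => ? ? [].
- rewrite (arm_adj_out (f := inl \o inl)) // (arm_adj_out (f := inr)) // !orbF.
  by rewrite arm_adj_sym (arm_adjNS (f := inl \o inr)) // => ? ? [].
- rewrite (arm_adj_out (f := inl \o inl)) // (arm_adj_out (f := inl \o inr)) //.
  by rewrite arm_adj_sym (arm_adjNS (f := inr)) // => ? ? [].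
Qed.

Lemma cl_vx k l i j : i < len k -> j < len l ->
  (vx k i \in cl_nbhd (vx l j)) = [&& k == l, i <= j.+1 & j <= i.+1].
Proof.
case: k l => [[|[|[|//]]] Hk] [[|[|[|//]]] Hl]; rewrite /len /vx /= => lt_i lt_j;
  rewrite !insub_ord inE /= /tree_adj /=.
2-4,6-8: by rewrite !arm_adj_outSS //; solve [by left | by right].
- rewrite [X in X || _](_ : _ = (i == j)) //
    (arm_adjSS (f := inl \o inl)); last by move=> ? ? [].
  by rewrite !arm_adj_outSS; [rewrite /=; lia | by right | by right].
- rewrite [X in X || _](_ : _ = (i == j)) //
    (arm_adjSS (f := inl \o inr)); last by move=> ? ? [].
  by rewrite !arm_adj_outSS; [rewrite /=; lia | by right | by right].
- rewrite [X in X || _](_ : _ = (i == j)) //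
    (arm_adjSS (f := inr)); last by move=> ? ? [].
  by rewrite !arm_adj_outSS; [rewrite /=; lia | by right | by right].
Qed.

Lemma vx_center k i : i < len k -> vx k i != center.
Proof.
by case: k => [[|[|[|//]]] Hk]; rewrite /len /vx /= => lt_i; rewrite insub_ord.
Qed.

Lemma vx_inj k l i j : i < len k -> j < len l ->
  (vx k i == vx l j) = (k == l) && (i == j).
Proof.
by case: k l => [[|[|[|//]]] Hk] [[|[|[|//]]] Hl]; rewrite /len /vx /= => lt_i lt_j;
  rewrite !insub_ord.
Qed.

Implicit Types (D : {set T}) (k l : 'I_3).

Definition word k D : seq bool := mkseq (fun i => vx k i \in D) (len k).

Lemma nth_word k D i : i < len k -> nth true (word k D) i = (vx k i \in D).
Proof. by move=> lt_i; rewrite nth_mkseq. Qed.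

Lemma size_word k D : size (word k D) = len k.
Proof. exact: size_mkseq. Qed.

Lemma word_play_vx k l D j : j < len l ->
  word k (play D (vx l j)) = if k == l then mark j (word k D) else word k D.
Proof.
move=> lt_j; apply: (@eq_from_nth _ true).
  by case: ifP; rewrite ?size_mark !size_word.
rewrite size_word => i lt_i; rewrite nth_word // inE cl_vx //.
by case: eqP => _; rewrite ?nth_mark nth_word //= orbF.
Qed.

Lemma word_play_center k D : word k (play D center) = mark_head (word k D).
Proof.
apply: (@eq_from_nth _ true); first by rewrite size_mark_head !size_word.
rewrite size_word => i lt_i; rewrite nth_mark_head !nth_word // inE.
by rewrite cl_center_vx.
Qed.

Lemma center_play_center D : center \in play D center.
Proof. by rewrite !inE eqxx orbT. Qed.

Lemma center_play_vx D k i : i < len k ->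
  (center \in play D (vx k i)) = (center \in D) || (i == 0).
Proof. by move=> lt_i; rewrite inE cl_sym cl_center_vx. Qed.

Lemma eq_words D D' : (center \in D) = (center \in D') ->
  (forall k, word k D = word k D') -> D = D'.
Proof.
move=> Ec Ew; apply/setP => x; case: (vxP x) => [->//|[k [i [lt_i ->]]]].
by rewrite -!nth_word ?Ew.
Qed.

End Spider.

Lemma game_over (G : sgraph) s (D : {set G}) :
  (forall v, ~~ legal D v) -> game_length s D = 0.
Proof.
move=> noL; rewrite game_lengthE; case: pickP => // v.
by rewrite (negPf (noL v)).
Qed.

Lemma weight_eq0 w i : weight 0 w = 0 -> nth true w i.
Proof.
elim: w i => [|[] w IH] i //=; first by rewrite nth_nil.
  by case: i => //= i; exact: IH.
by have [R [C E]] := lead_split w; rewrite (E 1).1 /run_weight addnS.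
Qed.

(** A run of length 3 modulo 4 weighs at least 4. This keeps the truncated subtractions of the
    bounds below from reaching zero early. *)
Lemma runs3_weight n w : 4 * runs3 n w <= weight n w.
Proof.
elim: w n => [|[] w IH] n //=; first by rewrite /run_weight /is_run3; lia.
by have := IH 0; rewrite /run_weight /is_run3; lia.
Qed.

Lemma sum_gt0 (F : 'I_3 -> nat) : 0 < \sum_k F k -> exists k, 0 < F k.
Proof.
move=> F_gt0; case: (pickP (fun k => 0 < F k)) => [k Fk|F0]; first by exists k.
by move: F_gt0; rewrite big1 // => k _; have := F0 k; case: (F k).
Qed.

(** * Upper bounds: strategies of Dominator *)

Section Upper.

Variables p q r : nat.
Local Notation T := (tree p q r).
Implicit Types (D : {set T}) (v : T) (k l : 'I_3).

Definition total_weight D := \sum_k weight 0 (word k D).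
Definition total_runs3 D := \sum_k runs3 0 (word k D).

Lemma total_runs3_weight D : 4 * total_runs3 D <= total_weight D.
Proof. by rewrite big_distrr leq_sum // => k _; exact: runs3_weight. Qed.

Lemma word_play D v k : word k (play D v) = word k D \/
  weight 0 (word k (play D v)) <= weight 0 (word k D)
  /\ 2 * weight 0 (word k (play D v)) + runs3 0 (word k D) + 1
     <= runs3 0 (word k (play D v)) + 2 * weight 0 (word k D).
Proof.
case: (vxP v) => [->|[l [j [lt_j ->]]]].
  by rewrite word_play_center; exact: mark_head_weight.
by rewrite word_play_vx //; case: ifP => _; [exact: mark_weight | left].
Qed.

Lemma total_weight_play D v : total_weight (play D v) <= total_weight D.
Proof. by apply: leq_sum => k _; case: (word_play D v k) => [->|[]]. Qed.

(** No arm raises the potential, and each altered arm lowers it, so one altered arm is enough. *)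
Lemma play_potential D v k : word k (play D v) <> word k D ->
  2 * total_weight (play D v) + total_runs3 D + 1
  <= total_runs3 (play D v) + 2 * total_weight D.
Proof.
move=> neq_k; rewrite /total_weight /total_runs3 !(bigD1 (P := predT) k) //=.
case: (word_play D v k) => // -[_ le_k].
have: \sum_(i < 3 | i != k) (weight 0 (word i (play D v))
       + weight 0 (word i (play D v)) + runs3 0 (word i D))
   <= \sum_(i < 3 | i != k) (runs3 0 (word i (play D v))
       + (weight 0 (word i D) + weight 0 (word i D))).
  by apply: leq_sum => i _; case: (word_play D v i) => [->|]; lia.
rewrite !big_split /=; move: le_k.
by do 4![move: (\sum_(i < 3 | i != k) _)]=> ? ? ? ?; lia.
Qed.

Lemma legal_word D v :
  (center p q r \in play D v) = (center p q r \in D) -> legal D v ->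
  exists k, word k (play D v) <> word k D.
Proof.
move=> cD /legal_playP neqD.
case: (pickP (fun k => word k (play D v) != word k D)) => [k /eqP|eqD].
  by exists k.
case: neqD; apply: eq_words => // k.
by move/negbFE: (eqD k) => /eqP.
Qed.

Lemma word_legal D v k : word k (play D v) <> word k D -> legal D v.
Proof. by move=> neq; apply/legal_playP => E; rewrite E in neq. Qed.

(** Only the term of arm [l] changes. The form without subtraction suits linear arithmetic, and [F]
    serves for both the weight and the number of runs. *)
Lemma sum_word_vx (F : seq bool -> nat) D l j : j < len p q r l ->
  \sum_k F (word k (play D (vx p q r l j))) + F (word l D)
  = \sum_k F (word k D) + F (mark j (word l D)).
Proof.
move=> lt_j; rewrite (bigD1 l) // [in RHS](bigD1 l) //= word_play_vx // eqxx.
rewrite addnAC [RHS]addnAC [in RHS](addnC (F (word l D))).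
by congr (_ + _); apply: eq_bigr => i /negPf ne; rewrite word_play_vx // ne.
Qed.

Lemma legal_vx D l j : j < len p q r l ->
  weight 0 (mark j (word l D)) < weight 0 (word l D) ->
  legal D (vx p q r l j).
Proof.
move=> lt_j lt_w; apply: (word_legal (k := l)).
by rewrite word_play_vx // eqxx => E; rewrite E ltnn in lt_w.
Qed.

Lemma odd_word D : odd (total_weight D) -> exists l, odd (weight 0 (word l D)).
Proof.
move=> oW; case: (pickP (fun l => odd (weight 0 (word l D)))) => [l ol|ev].
  by exists l.
suff: ~~ odd (total_weight D) by rewrite oW.
rewrite /total_weight; elim/big_ind: _ => // [x y|l _]; last by rewrite ev.
by rewrite oddD => /negPf-> /negPf->.
Qed.

(* [W] is the total weight and [c] the number of runs of length 3 modulo 4; each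
   of these runs offers Dominator a move that lowers [W] by 4 instead of 3, hence
   the corrections. *)
Definition bound_staller W c := (W + 1) %/ 2 - ((W %% 2 == 1) && (2 <= c)).
Definition bound_dominator W c :=
  W %/ 2 - ((W %% 2 == 0) && (1 <= c) || (W %% 2 == 1) && (3 <= c)).

(** Induction for both players at once. [play_potential] controls every move of Staller; Dominator
    answers by [reply_run3] if some run has length 3 modulo 4, else by [reply_odd] if the weight is
    odd, else by [reply_any]. *)
Lemma center_dominated_bound D : center p q r \in D ->
  game_length Staller D <= bound_staller (total_weight D) (total_runs3 D)
  /\ game_length Dominator D <= bound_dominator (total_weight D) (total_runs3 D).
Proof.
have [n] := ubnP #|~: D|; elim: n D => // n IH D; rewrite ltnS => le_n cD.
have {}IH v : legal D v ->
  game_length Staller (play D v)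
    <= bound_staller (total_weight (play D v)) (total_runs3 (play D v))
  /\ game_length Dominator (play D v)
    <= bound_dominator (total_weight (play D v)) (total_runs3 (play D v)).
  by move=> Lv; apply: IH; [exact: leq_trans (card_play Lv) le_n | rewrite inE cD].
have cE v : (center p q r \in play D v) = (center p q r \in D) by rewrite inE cD.
split.
  apply: staller_le => v Lv; apply: leq_ltn_trans (IH v Lv).2 _.
  have [k neq] := legal_word (cE v) Lv.
  have := play_potential neq; have := total_weight_play D v.
  have := total_runs3_weight D; have := total_runs3_weight (play D v).
  by rewrite /bound_staller /bound_dominator; lia.
case: (posnP (total_runs3 D)) => [c0|].
  case: (boolP (odd (total_weight D))) => [oW|eW].
    have [l ol] := odd_word oW.
    have [j [lt_j le_w _]] := reply_odd ol; rewrite size_word in lt_j.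
    have Lv : legal D (vx p q r l j) by apply: legal_vx => //; lia.
    apply: leq_trans (dominator_le Lv (IH _ Lv).1) _.
    have := sum_word_vx (weight 0) D lt_j.
    by rewrite -!/(total_weight _) /bound_staller /bound_dominator; lia.
  case: (posnP (total_weight D)) => [W0|W_gt0].
    rewrite game_over // => v; apply/negP => Lv.
    have [k []] := legal_word (cE v) Lv.
    apply: (@eq_from_nth _ true); rewrite ?size_word // => i lt_i.
    have w0 D' : total_weight D' = 0 -> nth true (word k D') i.
      rewrite /total_weight => /eqP; rewrite sum_nat_eq0.
      by move=> /forallP/(_ k)/eqP; exact: weight_eq0.
    by rewrite !w0 //; have := total_weight_play D v; lia.
  have [l wl] := sum_gt0 W_gt0.
  have [j [lt_j le_w]] := reply_any wl; rewrite size_word in lt_j.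
  have Lv : legal D (vx p q r l j) by apply: legal_vx => //; lia.
  apply: leq_trans (dominator_le Lv (IH _ Lv).1) _.
  have := sum_word_vx (weight 0) D lt_j.
  by rewrite -!/(total_weight _) /bound_staller /bound_dominator; lia.
move=> c_gt0.
have [l cl] := sum_gt0 c_gt0.
have [j [lt_j le_w le_c _]] := reply_run3 cl; rewrite size_word in lt_j.
have Lv : legal D (vx p q r l j) by apply: legal_vx => //; lia.
apply: leq_trans (dominator_le Lv (IH _ Lv).1) _.
have := sum_word_vx (weight 0) D lt_j; have := sum_word_vx (runs3 0) D lt_j.
rewrite -!/(total_weight _) -!/(total_runs3 _).
by rewrite /bound_staller /bound_dominator; lia.
Qed.

(** The undominated center costs one move over the uncorrected bounds for a dominated center. If
    Staller dominates the center, the previous lemma applies; if she keeps the leading runs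
    divisible by 4, induction does. *)
Lemma center_undominated_bound D : center p q r \notin D ->
  (forall k, lead (word k D) %% 4 = 0) ->
  game_length Staller D <= (total_weight D + 3) %/ 2
  /\ game_length Dominator D
     <= (total_weight D + 2) %/ 2
        - ((total_weight D %% 2 == 0) && (1 <= total_runs3 D)).
Proof.
have [n] := ubnP #|~: D|; elim: n D => // n IH D; rewrite ltnS => le_n cD leadD.
have {}IH D' : #|~: D'| < #|~: D| -> center p q r \notin D' ->
  (forall k, lead (word k D') %% 4 = 0) ->
  game_length Staller D' <= (total_weight D' + 3) %/ 2
  /\ game_length Dominator D' <= (total_weight D' + 2) %/ 2
        - ((total_weight D' %% 2 == 0) && (1 <= total_runs3 D')).
  by move=> lt_D'; apply: IH; exact: leq_trans lt_D' le_n.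
split.
  apply: staller_le => v Lv.
  have le_W := total_weight_play D v.
  have toU : center p q r \in play D v ->
      game_length Dominator (play D v) < (total_weight D + 3) %/ 2.
    move=> /center_dominated_bound[_ bD]; apply: leq_ltn_trans bD _.
    by rewrite /bound_dominator; lia.
  case: (vxP v) => [Ev|[l [[|j] [lt_j Ev]]]].
  - by apply: toU; rewrite Ev center_play_center.
  - by apply: toU; rewrite Ev center_play_vx // orbT.
  have cE : (center p q r \in play D v) = (center p q r \in D).
    by rewrite Ev center_play_vx // orbF.
  have wE : word l (play D v) = mark j.+1 (word l D) 
    by rewrite Ev word_play_vx // eqxx.
  have wE' k : k != l -> word k (play D v) = word k D.
    by rewrite Ev word_play_vx // => /negPf->.
  have [L0|L0] := eqVneq (lead (word l (play D v)) %% 4) 0.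
    have [||_ bD] := IH _ (card_play Lv); first by rewrite cE.
      by move=> k; have [->//|/wE'->] := eqVneq k l.
    apply: leq_ltn_trans bD _.
    have [k /play_potential] := legal_word cE Lv.
    by have := total_runs3_weight (play D v); lia.
  (* Staller has broken the leading run. Dominator repairs it at once, and the two moves together
     lower the weight by 4, exactly their share. *)
  rewrite wE in L0.
  have [i [i_gt0 lt_i leadE le_w]] := restore_lead (ltn0Sn j) (leadD l) L0.
  rewrite size_word in lt_i.
  have L1 : legal (play D v) (vx p q r l i).
    apply: (word_legal (k := l)); rewrite word_play_vx // eqxx wE => E.
    by rewrite E in leadE; rewrite leadE in L0.
  have [|||bS _] := IH (play (play D v) (vx p q r l i)).
  - exact: ltn_trans (card_play L1) (card_play Lv).
  - by rewrite center_play_vx // cE negb_or cD -lt0n.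
  - move=> k; rewrite word_play_vx //; have [->|/wE'->//] := eqVneq k l.
    by rewrite wE.
  have := sum_word_vx (weight 0) D lt_j.
  have := sum_word_vx (weight 0) (play D v) lt_i.
  rewrite -Ev wE -!/(total_weight _) => W2 W1.
  by apply: leq_ltn_trans (dominator_le L1 bS) _; lia.
have arm_reply l j m : 0 < j -> lead (mark j (word l D)) = lead (word l D) ->
  j < len p q r l -> weight 0 (mark j (word l D)) + m.+1 <= weight 0 (word l D) ->
  2 * game_length Dominator D + m.+1 <= total_weight D + 5.
  move=> j_gt0 leadE lt_j le_w.
  have Lv : legal D (vx p q r l j) by apply: legal_vx => //; lia.
  have [||bS _] := IH _ (card_play Lv).
  - by rewrite center_play_vx // negb_or cD -lt0n.
  - by move=> k; rewrite word_play_vx //; case: eqP => [->|_]; rewrite ?leadE.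
  have := dominator_le Lv bS.
  by have := sum_word_vx (weight 0) D lt_j; rewrite -!/(total_weight _); lia.
case: (boolP (odd (total_weight D))) => [oW|eW].
  have [l ol] := odd_word oW.
  have [j [lt_j le_w leadE]] := reply_odd ol; rewrite size_word in lt_j.
  have [|j_gt0 {}leadE] := leadE; first by rewrite leadD.
  by have := arm_reply _ _ 2 j_gt0 leadE lt_j le_w; lia.
(* With even weight and no run of length 3 modulo 4, Dominator plays the center: that is the one
   extra move. Otherwise [reply_run3] gains 4 away from the leading runs. *)
case: (posnP (total_runs3 D)) => [c0|c_gt0].
  have Lc : legal D (center p q r).
    by apply/legal_playP => E; rewrite -E center_play_center in cD.
  have [bS _] := center_dominated_bound (center_play_center D).
  apply: leq_trans (dominator_le Lc bS) _.
  by have := total_weight_play D (center p q r); rewrite /bound_staller; lia.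
have [l cl] := sum_gt0 c_gt0.
have [j [lt_j le_w _ leadE]] := reply_run3 cl; rewrite size_word in lt_j.
have [|j_gt0 {}leadE] := leadE; first by rewrite leadD.
have := total_runs3_weight D.
by have := arm_reply _ _ 3 j_gt0 leadE lt_j le_w; lia.
Qed.

Lemma len_mod4 k : len p q r k %% 4 = 0.
Proof. by rewrite modnMr. Qed.

Lemma sum_len : \sum_k len p q r k = 4 * (p + q + r).
Proof. by rewrite !big_ord_recl big_ord0 /len /=; lia. Qed.

Lemma sum_except (F : 'I_3 -> nat) l :
  (forall k, k != l -> F k = len p q r k) ->
  \sum_k F k + len p q r l = 4 * (p + q + r) + F l.
Proof.
move=> FE; rewrite -sum_len (bigD1 l) //= [in RHS](bigD1 l) //= (eq_bigr _ FE).
by rewrite addnC addnA [RHS]addnAC.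
Qed.

Lemma word_set0 k : word k (set0 : {set T}) = nseq (len p q r k) false.
Proof.
apply: (@eq_from_nth _ true); rewrite size_word ?size_nseq // => i lt_i.
by rewrite nth_word // nth_nseq lt_i inE.
Qed.

Lemma word_set_center k :
  word k [set center p q r] = nseq (len p q r k) false.
Proof.
apply: (@eq_from_nth _ true); rewrite size_word ?size_nseq // => i lt_i.
by rewrite nth_word // nth_nseq lt_i inE (negPf (vx_center lt_i)).
Qed.

Lemma word_set_vx k l e : e < len p q r l -> word k [set vx p q r l e] =
  if k == l then nseq e false ++ true :: nseq (len p q r l - e.+1) false
  else nseq (len p q r k) false.
Proof.
move=> lt_e; apply: (@eq_from_nth _ true) => [|i].
  by rewrite size_word; case: eqP => [->|_]; rewrite ?size_cat /= !size_nseq //; lia.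
rewrite size_word => lt_i; rewrite nth_word // inE vx_inj //.
case: eqP => [E|_]; last by rewrite nth_nseq lt_i.
rewrite nth_cat size_nseq nth_nseq; rewrite E in lt_i.
case: (ltngtP i e) => [lt|gt|->]; rewrite ?subnn //.
have -> : i - e = (i - e.+1).+1 by lia.
by rewrite /= nth_nseq; have -> : i - e.+1 < len p q r l - e.+1 by lia.
Qed.

Lemma weight_full k : weight 0 (nseq (len p q r k) false) = len p q r k.
Proof. by rewrite weight_nseq /run_weight len_mod4 add0n. Qed.

Hypotheses (p_gt0 : 0 < p) (q_gt0 : 0 < q) (r_gt0 : 0 < r).

Lemma len_gt0 k : 0 < len p q r k.
Proof. by case: k => [[|[|[|//]]] Hk]; rewrite /len /=; lia. Qed.

Lemma mark_head_full k :
  mark_head (nseq (len p q r k) false) = true :: nseq (len p q r k).-1 false.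
Proof. by case: len (len_gt0 k). Qed.

(** The remaining run has length 3 modulo 4, and its extra unit makes up for the dominated
    vertex. *)
Lemma weight_headless k :
  weight 0 (true :: nseq (len p q r k).-1 false) = len p q r k.
Proof.
rewrite /= weight_nseq /run_weight.
by have := len_gt0 k; have := len_mod4 k; lia.
Qed.

Lemma legal_center D : center p q r \notin D -> legal D (center p q r).
Proof.
by move=> cD; apply/legal_playP => E; rewrite -E center_play_center in cD.
Qed.

Lemma gamma_tree_le : gamma_g T <= 2 * (p + q + r) + 1.
Proof.
have Lc : legal (set0 : {set T}) (center p q r) by rewrite legal_center ?inE.
have [bS _] := center_dominated_bound (center_play_center (set0 : {set T})).
have W : total_weight (play (set0 : {set T}) (center p q r)) = 4 * (p + q + r).
  rewrite -sum_len; apply: eq_bigr => k _.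
  by rewrite word_play_center word_set0 mark_head_full weight_headless.
by have := dominator_le Lc bS; rewrite W /bound_staller /gamma_g; lia.
Qed.

Lemma predominated_center : gamma_g_predom (center p q r) <= 2 * (p + q + r).
Proof.
have [_ bD] := center_dominated_bound (set11 (center p q r)).
have W : total_weight [set center p q r] = 4 * (p + q + r).
  by rewrite -sum_len; apply: eq_bigr => k _; rewrite word_set_center weight_full.
by apply: leq_trans bD _; rewrite W /bound_dominator; lia.
Qed.

Lemma predominated_vx l e : e < len p q r l ->
  gamma_g_predom (vx p q r l e) <= 2 * (p + q + r).
Proof.
move=> lt_e; rewrite /gamma_g_predom; set v := vx p q r l e.
have N_gt0 : 0 < p + q + r by lia.
have lenE := len_mod4 l; have len0 := len_gt0 l.
have wl : word l [set v] = nseq e false ++ true :: nseq (len p q r l - e.+1) false.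
  by rewrite word_set_vx // eqxx.
have wk k : k != l -> word k [set v] = nseq (len p q r k) false.
  by rewrite word_set_vx // => /negPf->.
have cv : center p q r \notin [set v] by rewrite inE eq_sym vx_center.
(* Position [e] is at distance [e + 1] from the center. Playing [e + 2] completes a dominated block
   of four between runs of length divisible by 4; the loss of 4 in weight pays for the undominated
   center. *)
have [e0|e0] := eqVneq (e %% 4) 0.
  have lt_e2 : e + 2 < len p q r l by lia.
  set D := play [set v] (vx p q r l (e + 2)).
  have wlD : word l D = nseq e false
      ++ [:: true, true, true, true & nseq (len p q r l - e - 4) false].
    rewrite word_play_vx // eqxx wl addn2 -[e.+2]addn1 mark_run.
    by have -> : len p q r l - e.+1 = (len p q r l - e - 4).+3 by lia.
  have wkD k : k != l -> word k D = nseq (len p q r k) false.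
    by move=> kl; rewrite word_play_vx // (negPf kl) wk.
  have Wl : weight 0 (word l D) = len p q r l - 4.
    by rewrite wlD weight_run /= weight_nseq /run_weight; lia.
  have W := @sum_except (fun k => weight 0 (word k D)) l.
  have {}W : total_weight D + len p q r l = 4 * (p + q + r) + (len p q r l - 4).
    by rewrite -Wl W // => k /wkD->; rewrite weight_full.
  have Lv : legal [set v] (vx p q r l (e + 2)).
    apply: (word_legal (k := l)); rewrite -/D wlD wl => /(congr1 (weight 0)).
    by rewrite !weight_run /= !weight_nseq /run_weight; lia.
  have [||bS _] := @center_undominated_bound D.
  - by rewrite center_play_vx // (negPf cv) addn2.
  - move=> k; have [->|/wkD->] := eqVneq k l; first by rewrite wlD lead_run.
    by rewrite lead_nseq len_mod4.
  by apply: leq_trans (dominator_le Lv bS) _; lia.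
(* After the center is played, the runs of this arm have lengths 0 and 2 modulo 4, so the total
   weight is odd. The other two arms supply the two runs of length 3 modulo 4 that trigger the
   correction in [bound_staller]. *)
have [e1|e1] := eqVneq (e %% 4) 1.
  have Lc := legal_center cv.
  have [bS _] := center_dominated_bound (center_play_center [set v]).
  apply: leq_trans (dominator_le Lc bS) _; set D := play _ _.
  have wkD k : k != l -> word k D = true :: nseq (len p q r k).-1 false.
    by move=> kl; rewrite word_play_center wk // mark_head_full.
  have Wl : weight 0 (word l D) = len p q r l - 1.
    rewrite word_play_center wl; case: (e) e1 lt_e => // e' e1 lt_e.
    rewrite /mark_head /= -/(nseq _ _) -/(cat _ _) weight_run weight_nseq.
    by rewrite /run_weight; lia.
  have W := @sum_except (fun k => weight 0 (word k D)) l.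
  have {}W : total_weight D + len p q r l = 4 * (p + q + r) + (len p q r l - 1).
    by rewrite -Wl W // => k /wkD->; rewrite weight_headless.
  have c3 : 2 <= total_runs3 D.
    rewrite /total_runs3 (bigD1 l) //=; apply: leq_trans (leq_addl _ _).
    rewrite (eq_bigr (fun=> 1)) => [|k /wkD->].
      by rewrite sum1_card cardC1 card_ord.
    rewrite /= runs3_nseq /is_run3; have := len_mod4 k; have := len_gt0 k; lia.
  by rewrite /bound_staller; lia.
(* For [e] congruent to 2 or 3, the neighbour of the center on this arm dominates the center and the
   first two positions. One remaining run has length divisible by 4, the other length 1 modulo 4, so
   the weight drops by 2. *)
set D := play [set v] (vx p q r l 0).
have wkD k : k != l -> word k D = nseq (len p q r k) false.
  by move=> kl; rewrite word_play_vx // (negPf kl) wk.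
have Wl : weight 0 (word l D) = len p q r l - 2.
  rewrite word_play_vx // eqxx wl; case: (e) e0 e1 lt_e => [|[|e']] // e0 e1 lt_e.
  rewrite [mark 0 _]/= -/(nseq _ _) -/(cat _ _) [LHS]/= weight_run weight_nseq.
  by rewrite /run_weight; lia.
have W := @sum_except (fun k => weight 0 (word k D)) l.
have {}W : total_weight D + len p q r l = 4 * (p + q + r) + (len p q r l - 2).
  by rewrite -Wl W // => k /wkD->; rewrite weight_full.
have Lv : legal [set v] (vx p q r l 0).
  by apply/legal_playP => E; move: cv; rewrite -E center_play_vx // orbT.
have cD : center p q r \in D by rewrite center_play_vx // orbT.
have [bS _] := center_dominated_bound cD.
apply: leq_trans (dominator_le Lv bS) _.
by rewrite /bound_staller; lia.
Qed.

End Upper.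

(** * Counting undominated vertices, and residues modulo 4 *)

Lemma count_mark j w :
  count negb (mark j w) <= count negb w <= count negb (mark j w) + minn (j + 2) 3.
Proof.
elim: w j => [|a w IH] [|[|j]] //.
- by case: w {IH} => [|b w]; case: a => //=; case: b => /=; lia.
- by case: w {IH} => [|b [|c w]]; case: a => //=; case: b => //=;
    try case: c => /=; lia.
have -> : mark j.+2 (a :: w) = a :: mark j.+1 w by rewrite /= orbF.
by have := IH j.+1; rewrite /=; lia.
Qed.

Lemma count_mark_head w : count negb w = count negb (mark_head w) + ~~ nth true w 0.
Proof. by case: w => //= a w; rewrite addnC. Qed.

Lemma count_update w w' i : size w' = size w -> nth true w i = false ->
  (forall j, nth true w' j = nth true w j || (j == i)) ->
  count negb w = (count negb w').+1.
Proof.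
elim: w w' i => [|a w IH] [|a' w'] [|i] //=; move=> [sz] wi E.
  have := E 0; rewrite /= orbT wi => ->; rewrite add0n; congr _.+1; congr count.
  by apply: (@eq_from_nth _ true) => // j _; have := E j.+1; rewrite /= orbF.
have := E 0; rewrite /= orbF => ->; rewrite -addnS; congr addn.
by apply: IH sz wi _ => j; exact: E j.+1.
Qed.

Lemma word_boundary w : true \in w -> false \in w ->
  exists i, i.+1 < size w /\ nth true w i != nth true w i.+1.
Proof.
elim: w => [|a [|b w] IH] //; first by case: a.
have [ab|ab] := eqVneq a b; last by exists 0.
subst b.
move=> tw fw; case: IH => [||i [lt_i neq]]; last by exists i.+1.
  by move: tw; rewrite inE; case: a {fw}.
by move: fw; rewrite inE; case: a {tw}.
Qed.

(** Turns sums over the arms into explicit three-term sums, with a chosen arm first, for linear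
    arithmetic. *)
Lemma three_arms (l : 'I_3) : exists a b : 'I_3,
  [/\ a != l, b != l, forall k, [|| k == l, k == a | k == b]
    & forall F : 'I_3 -> nat, \sum_k F k = F l + F a + F b].
Proof.
pose o n (lt_n : n < 3) := Ordinal lt_n.
have S (F : 'I_3 -> nat) : \sum_k F k = F (o 0 isT) + F (o 1 isT) + F (o 2 isT).
  rewrite !big_ord_recl big_ord0 addn0 addnA.
  by congr (F _ + F _ + F _); apply: val_inj.
case: l => [[|[|[|//]]] lt_l].
- exists (o 1 isT), (o 2 isT); split=> // [|F]; first by case=> [[|[|[|]]]].
  by rewrite S; congr (F _ + _ + _); apply: val_inj.
- exists (o 0 isT), (o 2 isT); split=> // [|F]; first by case=> [[|[|[|]]]].
  by rewrite S (addnC (F _)); congr (F _ + _ + _); apply: val_inj.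
- exists (o 0 isT), (o 1 isT); split=> // [|F]; first by case=> [[|[|[|]]]].
  by rewrite S addnC addnA; congr (F _ + _ + _); apply: val_inj.
Qed.

(** The residue sum is 5 or 9. From 9 it falls to 8. From 5 it falls to 4, and no residue 3 is left:
    two residues 3 would exceed 5, and a single one is the one lowered. *)
Lemma residues_decr1 x y z :
  (x.+1 + y + z) %% 4 = 1 -> 5 <= x.+1 %% 4 + y %% 4 + z %% 4 ->
  x.+1 %% 4 = 3 \/ [/\ x.+1 %% 4 != 3, y %% 4 != 3 & z %% 4 != 3] ->
  8 <= x %% 4 + y %% 4 + z %% 4 \/
  4 <= x %% 4 + y %% 4 + z %% 4 /\ [/\ x %% 4 != 3, y %% 4 != 3 & z %% 4 != 3].
Proof.
have := ltn_pmod z (isT : 0 < 4); have := ltn_pmod y (isT : 0 < 4).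
have := ltn_pmod x (isT : 0 < 4).
rewrite -addnA -modnDm -(modnDm y) -(addn1 x) -(modnDm x).
move: (x %% 4) (y %% 4) (z %% 4) => a b c.
case: a => [|[|[|[|//]]]] _; case: b => [|[|[|[|//]]]] _;
case: c => [|[|[|[|//]]]] _ //= _ _.
all: by first [by left | by right | case=> [//|[]]].
Qed.

(** Removing 3 raises a residue by 1, except that 3 becomes 0. A sum of 8 survives even this loss of
    3; a sum of 4 must avoid it. *)
Lemma residues_decr3 x y z :
  8 <= (x + 3) %% 4 + y %% 4 + z %% 4 \/
  4 <= (x + 3) %% 4 + y %% 4 + z %% 4 /\ (x + 3) %% 4 != 3 ->
  (x + 3 + y + z) %% 4 = 0 -> 5 <= x %% 4 + y %% 4 + z %% 4.
Proof.
have := ltn_pmod z (isT : 0 < 4); have := ltn_pmod y (isT : 0 < 4).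
have := ltn_pmod x (isT : 0 < 4).
rewrite -(addnA (x + 3)) -(modnDm (x + 3)) -(modnDm y) -(modnDm x).
move: (x %% 4) (y %% 4) (z %% 4) => a b c.
case: a => [|[|[|[|//]]]] _; case: b => [|[|[|[|//]]]] _;
case: c => [|[|[|[|//]]]] _ //=.
all: by case=> [//|[]].
Qed.

(** * Lower bound: the strategy of Staller *)

Section Lower.

Variables p q r : nat.
Local Notation T := (tree p q r).
Local Notation center := (center p q r).
Local Notation vx := (vx p q r).
Local Notation len := (len p q r).
Implicit Types (D : {set T}) (v : T) (k l : 'I_3).
Hypotheses (p_gt0 : 0 < p) (q_gt0 : 0 < q) (r_gt0 : 0 < r).

(* True of the positions reached from [set0], which are unions of closed
   neighbourhoods, but false of [set v]. *)
Definition nbhd_union D :=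
  forall x, x \in D -> exists2 z, z \in cl_nbhd x & cl_nbhd z \subset D.

Lemma nbhd_union_play D v : nbhd_union D -> nbhd_union (play D v).
Proof.
move=> gD x; rewrite inE => /orP[/gD[z zx zD]|xv].
  by exists z => //; apply: subset_trans zD (subsetUl _ _).
by exists v; rewrite ?subsetUr // cl_sym.
Qed.

Definition undom k D := count negb (word k D).
Definition undominated D := (center \notin D) + \sum_k undom k D.

(** Take neighbours on the arm, one dominated and one not. As [D] is a union of closed
    neighbourhoods, the dominated one was dominated from its far side, so its other neighbour is
    dominated too; playing it dominates one new vertex. *)
Lemma take_one k D : nbhd_union D -> true \in word k D -> 0 < undom k D ->
  exists j, [/\ j < len k, undom k D = (undom k (play D (vx k j))).+1
    & (center \in play D (vx k j)) = (center \in D)].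
Proof.
move=> gD tw u_gt0; have fw : false \in word k D.
  by move: u_gt0; rewrite -has_count => /hasP[[]].
have [i [lt_i neq]] := word_boundary tw fw; rewrite size_word in lt_i.
have lt_i' : i < len k by lia.
have sz j : size (mark j (word k D)) = size (word k D) by rewrite size_mark.
case ui : (nth true (word k D) i) neq => /=; case uSi: nth => // _.
- have Di : vx k i \in D by rewrite -nth_word.
  have DSi : vx k i.+1 \in D = false by rewrite -nth_word.
  have [z zi zD] := gD _ Di; have zN x : x \notin D -> x \notin cl_nbhd z.
    by apply: contra; exact: (subsetP zD).
  (* The far neighbour is position [i.-1], or the center when [i = 0]. *)
  have [prev cE] : (0 < i -> nth true (word k D) i.-1)
      /\ (center \in D) || (i == 0) = (center \in D).
    case: (vxP z) => [Ez|[l [m [lt_m Ez]]]].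
      rewrite Ez cl_sym cl_center_vx // in zi; rewrite (eqP zi); split=> //.
      by rewrite (subsetP zD) // Ez cl_refl.
    have := zN (vx k i.+1); rewrite DSi => /(_ isT); rewrite Ez cl_vx //.
    move: zi; rewrite Ez cl_vx // => /and3P[/eqP El ? ?]; subst l.
    rewrite eqxx /= => ne; have Em : m = i.-1 by lia.
    have i_gt0 : 0 < i by lia.
    rewrite gtn_eqF // orbF; split=> // _; rewrite nth_word; last by lia.
    by rewrite -Em (subsetP zD) // Ez cl_vx // eqxx; lia.
  exists i; split=> //; last by rewrite center_play_vx.
  rewrite /undom word_play_vx // eqxx.
  apply: (count_update (i := i.+1)) => // j; rewrite nth_mark.
  have [->|jS] := eqVneq j i.+1; first by clear; lia.
  have [->|ji] := eqVneq j i; first by rewrite ui.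
  have [jE|ji'] := eqVneq j i.-1; last by clear -jS ji ji'; lia.
  by rewrite jE prev //; clear -ji jE; lia.
- have DSi : vx k i.+1 \in D by rewrite -nth_word.
  have Di : vx k i \in D = false by rewrite -nth_word.
  have [z zi zD] := gD _ DSi; have zN x : x \notin D -> x \notin cl_nbhd z.
    by apply: contra; exact: (subsetP zD).
  have next : nth true (word k D) i.+2.
    case: (vxP z) => [Ez|[l [m [lt_m Ez]]]].
      by rewrite Ez cl_sym cl_center_vx in zi.
    have := zN (vx k i); rewrite Di => /(_ isT); rewrite Ez cl_vx //.
    move: zi; rewrite Ez cl_vx // => /and3P[/eqP El ? ?]; subst l.
    rewrite eqxx /= => ne; have Em : m = i.+2 by lia.
    by rewrite nth_word -Em // (subsetP zD) // Ez cl_vx // eqxx; lia.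
  exists i.+1; split=> //; last by rewrite center_play_vx // orbF.
  rewrite /undom word_play_vx // eqxx.
  apply: (count_update (i := i)) => // j; rewrite nth_mark.
  have [->|jS] := eqVneq j i.+1; first by rewrite uSi.
  have [->|ji] := eqVneq j i; first by clear; lia.
  have [->|ji'] := eqVneq j i.+2; last by clear -jS ji ji'; lia.
  by rewrite next.
Qed.


Lemma undom_play_vx k l D j : j < len l -> k != l ->
  undom k (play D (vx l j)) = undom k D.
Proof. by move=> lt_j /negPf kl; rewrite /undom word_play_vx // kl. Qed.

(** The cap is 2 at position 0, whose third closed neighbour, the center, is off the arm. *)
Lemma undom_play_bound l D j : j < len l ->
  undom l (play D (vx l j)) <= undom l D
    <= undom l (play D (vx l j)) + minn (j + 2) 3.
Proof. by move=> lt_j; rewrite /undom word_play_vx // eqxx count_mark. Qed.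

Lemma undom_play_center k D :
  undom k D = undom k (play D center) + (vx k 0 \notin D).
Proof.
by rewrite /undom word_play_center -nth_word ?len_gt0 // count_mark_head.
Qed.

Lemma undominated_play_vx l D j : j < len l ->
  undominated D <= undominated (play D (vx l j)) + 3.
Proof.
move=> lt_j; have [a [b [al bl _ S]]] := three_arms l.
rewrite /undominated !S (undom_play_vx D lt_j al) (undom_play_vx D lt_j bl).
rewrite center_play_vx //.
by have := undom_play_bound D lt_j; case: (center \in D); lia.
Qed.

Lemma undominated_legal D : 0 < undominated D -> exists v, legal D v.
Proof.
have leg x : x \notin D -> exists v, legal D v.
  by move=> xD; exists x; apply/subsetPn; exists x; rewrite ?cl_refl.
rewrite /undominated; case: (boolP (center \in D)) => [_|/leg//].
rewrite add0n => /sum_gt0[k]; rewrite -has_count => /(has_nthP true)[i].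
rewrite size_word => lt_i; rewrite nth_word //; exact: leg.
Qed.

(** The only situation in which a single move, at the center, dominates four new vertices. *)
Definition fresh_center D :=
  (center \notin D) && [forall k, vx k 0 \notin D].

Lemma fresh_center_play D v : (fresh_center (play D v) <= fresh_center D).
Proof.
suff: fresh_center (play D v) -> fresh_center D by case: fresh_center => // ->.
have sub x : x \notin play D v -> x \notin D.
  by apply: contra => xD; rewrite inE xD.
case/andP => cD /forallP hD; rewrite /fresh_center sub //=.
by apply/forallP => k; exact: sub.
Qed.

(* The fourth vertex dominated by a move at a fresh center is discounted, so
   that every move lowers the count by at most three. *)
Definition discounted D := undominated D - fresh_center D.

Lemma discounted_play D v : discounted D <= discounted (play D v) + 3.
Proof.
have := @fresh_center_play D v; rewrite /discounted.
case: (vxP v) => [->|[l [j [lt_j ->]]]]; last first.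
  have := undominated_play_vx D lt_j.
  by lia.
have -> : fresh_center (play D center) = false.
  by rewrite /fresh_center center_play_center.
move=> _; rewrite /undominated center_play_center /fresh_center.
have [a [b [_ _ all3 S]]] := three_arms ord0.
rewrite !S ![undom _ D]undom_play_center.
case: (boolP (center \in D)) => cD /=; first lia.
case: forallP => [hD|]; first lia.
case: (boolP (vx ord0 0 \in D)); first lia.
case: (boolP (vx a 0 \in D)); first lia.
case: (boolP (vx b 0 \in D)); first lia.
by move=> hb ha h0 []// k; case/or3P: (all3 k) => /eqP->.
Qed.

Lemma word_full k D : false \notin word k D -> undom k D = 0.
Proof.
move=> fw; apply/eqP; rewrite -leqn0 leqNgt -has_count.
by apply/hasPn => -[] // /(negP fw).
Qed.

Lemma word_empty k D : true \notin word k D ->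
  undom k D = len k /\ vx k 0 \notin D.
Proof.
move=> tw; split.
  rewrite -(size_word k D); apply/eqP; rewrite -all_count; apply/allP => -[]//.
  by move/(negP tw).
rewrite -nth_word ?len_gt0 //; apply: contra tw => <-.
by rewrite mem_nth // size_word len_gt0.
Qed.

(** A partly dominated arm allows [take_one]; otherwise every arm is entirely dominated or entirely
    undominated. *)
Lemma staller_move D : nbhd_union D -> D != set0 -> 0 < undominated D ->
  exists v, legal D v /\ (undominated D <= undominated (play D v) + 1
    \/ [/\ center \in D, undominated D %% 4 = 0
         & undominated D <= undominated (play D v) + 2]).
Proof.
move=> gD D0 u_gt0.
case: (pickP (fun k => (true \in word k D) && (false \in word k D))) => [k|mono].
  case/andP=> tw fw; have uk : 0 < undom k D.
    by rewrite -has_count; apply/hasP; exists false.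
  have [j [lt_j uE cE]] := take_one gD tw uk; exists (vx k j); split.
    by apply/legal_playP => E; rewrite E in uE; lia.
  left; have [a [b [ak bk _ S]]] := three_arms k.
  rewrite /undominated cE !S (undom_play_vx D lt_j ak) (undom_play_vx D lt_j bk).
  by rewrite uE; lia.
have {}mono k : undom k D = 0 \/ true \notin word k D.
  have := mono k; case: (boolP (false \in _)) => [_|/word_full]; last by left.
  by rewrite andbT => /negbT; right.
have [a [b [_ _ all3 S]]] := three_arms ord0.
(* If the center is dominated, so is one of its neighbours, and playing it dominates at most two new
   vertices. Otherwise some arm is fully dominated, and its vertex next to the center dominates only
   the center. *)
case: (boolP (center \in D)) => cD.
  have [k] : exists k, 0 < undom k D.
    by apply: sum_gt0; move: u_gt0; rewrite /undominated cD.
  case: (mono k) => [->//|/word_empty[_ hk] _]; exists center; split.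
    apply/legal_playP => E; move: hk.
    by rewrite -E inE cl_center_vx ?len_gt0 // orbT.
  right; split=> //.
    have m4 i : undom i D %% 4 = 0.
      by case: (mono i) => [->|/word_empty[-> _]] //; exact: len_mod4.
    by rewrite /undominated cD S; have := m4 ord0; have := m4 a; have := m4 b; lia.
  have [l hl] : exists l, vx l 0 \in D.
    have [z zc zD] := gD _ cD.
    case: (vxP z) => [Ez|[l [m [lt_m Ez]]]].
      by exists k; rewrite (subsetP zD) // Ez cl_center_vx // len_gt0.
    exists l; rewrite (subsetP zD) //; move: zc; rewrite Ez cl_center_vx //.
    by move=> /eqP->; exact: cl_refl.
  rewrite /undominated cD center_play_center.
  have [a' [b' [_ _ _ S']]] := three_arms l.
  by rewrite !S' ![undom _ D]undom_play_center hl; lia.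
have [x xD] := set0Pn _ D0.
case: (vxP x) xD => [->|[k [i [lt_i ->]]]] xD; first by rewrite xD in cD.
have fullk : undom k D = 0.
  case: (mono k) => // /negP[]; have := @mem_nth _ true (word k D) i.
  by rewrite size_word nth_word // xD => ->.
exists (vx k 0); have lt0 := len_gt0 p_gt0 q_gt0 r_gt0 k; split.
  by apply/legal_playP => E; move: cD; rewrite -E center_play_vx // orbT.
left; have [a' [b' [ak bk _ S']]] := three_arms k.
by rewrite /undominated cD center_play_vx // orbT !S' (undom_play_vx D lt0 ak)
  (undom_play_vx D lt0 bk) fullk; lia.
Qed.

(** Moves left when Staller dominates one new vertex per move and Dominator three. A Staller move
    dominating two at a multiple of 4 costs nothing, as [count_dominator] agrees at [u - 1] and
    [u - 2]. *)
Definition count_staller u := (u + 2) %/ 4 * 2 + (u %% 4 == 1).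
Definition count_dominator u := u %/ 4 * 2 + (u %% 4 != 0).

Lemma play_neq0 D v : play D v != set0.
Proof. by apply/set0Pn; exists v; rewrite inE cl_refl orbT. Qed.

Lemma count_bound D : nbhd_union D ->
  (D != set0 -> count_staller (discounted D) <= game_length Staller D)
  /\ count_dominator (discounted D) <= game_length Dominator D.
Proof.
have [n] := ubnP #|~: D|; elim: n D => // n IH D; rewrite ltnS => le_n gD.
have {}IH v : legal D v ->
  count_staller (discounted (play D v)) <= game_length Staller (play D v)
  /\ count_dominator (discounted (play D v)) <= game_length Dominator (play D v).
  move=> Lv; have [|sB dB] := IH _ (leq_trans (card_play Lv) le_n).
    exact: nbhd_union_play.
  by split=> //; exact: sB (play_neq0 _ _).
case: (posnP (discounted D)) => [->//|d_gt0].
have u_gt0 : 0 < undominated D by move: d_gt0; rewrite /discounted; lia.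
split.
  move=> D0; have [v [Lv Hv]] := staller_move gD D0 u_gt0.
  have := staller_ge Lv (IH v Lv).2; have := @fresh_center_play D v.
  move: d_gt0; rewrite /discounted /count_staller /count_dominator.
  case: Hv => [le_u|[cD u4 le_u]].
    by lia.
  by rewrite /fresh_center cD inE cD /=; lia.
have [v0 L0] := undominated_legal u_gt0.
have := @dominator_ge _ D v0 (count_staller (discounted D - 3)) L0.
have H v : legal D v ->
    count_staller (discounted D - 3) <= game_length Staller (play D v).
  move=> Lv; apply: leq_trans (IH v Lv).1.
  by have := discounted_play D v; rewrite /count_staller; lia.
by move=> /(_ H); rewrite /count_staller /count_dominator; lia.
Qed.


Definition residues D := \sum_k undom k D %% 4.

(** One move better than [count_bound]. Staller takes one vertex, from an arm of residue 3 if there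
    is one, and the residue lemmas carry the invariant through a round. Dominator cannot take three
    forever, since a positive residue sum leaves something undominated. *)
Lemma center_played_bound D : nbhd_union D -> cl_nbhd center \subset D ->
  (undominated D %% 4 = 1 -> 5 <= residues D ->
     undominated D + 3 <= 2 * game_length Staller D)
  /\ (undominated D %% 4 = 0 ->
      8 <= residues D \/ 4 <= residues D /\ (forall k, undom k D %% 4 != 3) ->
      undominated D + 2 <= 2 * game_length Dominator D).
Proof.
have [n] := ubnP #|~: D|; elim: n D => // n IH D; rewrite ltnS => le_n gD cD.
have {}IH v : legal D v -> _ := fun Lv => IH (play D v)
  (leq_trans (card_play Lv) le_n) (@nbhd_union_play _ v gD)
  (subset_trans cD (subsetUl _ _)).
have cU D' : D \subset D' -> undominated D' = \sum_k undom k D'.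
  by move=> DD'; rewrite /undominated (subsetP DD') // (subsetP cD) ?cl_refl.
have cP v : undominated (play D v) = \sum_k undom k (play D v).
  by apply: cU; exact: subsetUl.
have cU0 := cU D (subxx _).
split=> [U1 E5|U0 E].
  have [l l_gt0 l3] : exists2 l, 0 < undom l D &
      (undom l D %% 4 = 3 \/ forall k, undom k D %% 4 != 3).
    case: (pickP (fun k => undom k D %% 4 == 3)) => [k /eqP k3|no3].
      by exists k; [lia | left].
    have [|k k_gt0] := @sum_gt0 (undom^~ D); first by rewrite -cU0; lia.
    by exists k => //; right=> i; rewrite no3.
  have tw : true \in word l D.
    have hl : vx l 0 \in D by rewrite (subsetP cD) // cl_center_vx ?len_gt0.
    by rewrite -[true]hl -nth_word ?len_gt0 // mem_nth // size_word len_gt0.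
  have [j [lt_j uE _]] := take_one gD tw l_gt0.
  have Lv : legal D (vx l j) by apply/legal_playP => EE; rewrite EE in uE; lia.
  have [a [b [al bl all3 S]]] := three_arms l.
  have ua := undom_play_vx D lt_j al; have ub := undom_play_vx D lt_j bl.
  have [_ dB] := IH _ Lv.
  have := staller_ge Lv (leqnn _).
  move: U1 E5 dB; rewrite cP cU0 /residues !S ua ub uE => U1 E5 dB.
  have l3' : (undom l (play D (vx l j))).+1 %% 4 = 3 \/
      [/\ (undom l (play D (vx l j))).+1 %% 4 != 3, undom a D %% 4 != 3
        & undom b D %% 4 != 3].
    by rewrite -uE; case: l3 => [|no3]; [left | right].
  have E' := residues_decr1 U1 E5 l3'.
  have {}E' :
    8 <= undom l (play D (vx l j)) %% 4 + undom a D %% 4 + undom b D %% 4 \/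
    4 <= undom l (play D (vx l j)) %% 4 + undom a D %% 4 + undom b D %% 4
    /\ forall k, undom k (play D (vx l j)) %% 4 != 3.
    case: E' => [|[E4 [nl na nb]]]; [by left | right; split=> // k].
    by case/or3P: (all3 k) => /eqP->; rewrite ?ua ?ub.
  have U0 : (undom l (play D (vx l j)) + undom a D + undom b D) %% 4 = 0.
    by clear -U1; lia.
  by have := dB U0 E'; clear; lia.
have U_gt0 : 0 < undominated D.
  rewrite lt0n cU0; apply: contraTneq (leq0n 0) => U00.
  have uk k : undom k D = 0.
    by apply/eqP; move/eqP: U00; rewrite sum_nat_eq0 => /forallP/(_ k).
  have : residues D = 0 by rewrite /residues big1 // => k _; rewrite uk.
  by case: E => [|[]]; lia.
have [v0 L0] := undominated_legal U_gt0.
suff H v : legal D v -> (undominated D) %/ 2 <= game_length Staller (play D v).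
  by have := dominator_ge L0 H; lia.
move=> Lv; have [sB _] := IH v Lv.
have fc D' : D \subset D' -> fresh_center D' = false.
  by move=> DD'; rewrite /fresh_center (subsetP DD') // (subsetP cD) ?cl_refl.
have [cB _] := count_bound (@nbhd_union_play _ v gD).
have {cB} := cB (play_neq0 D v).
rewrite /discounted fc ?subsetUl // subn0 /count_staller => cB.
have := discounted_play D v; rewrite /discounted !fc ?subsetUl // !subn0 => le3.
(* If Dominator gains at most two vertices, [count_bound] already gives the extra move. *)
have [le2|gt2] := leqP (undominated D) (undominated (play D v) + 2).
  by move: cB; lia.
have {le3 gt2 cB} dE : undominated D = undominated (play D v) + 3 by lia.
case: (vxP v) => [Ev|[l [j [lt_j Ev]]]].
  by move: Lv; rewrite Ev /legal cD.
have [a [b [al bl all3 S]]] := three_arms l.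
have ua := undom_play_vx D lt_j al; have ub := undom_play_vx D lt_j bl.
rewrite -Ev in ua ub.
suff: 5 <= residues (play D v).
  have U1 : undominated (play D v) %% 4 = 1 by clear -dE U0; lia.
  by move/(sB U1); clear -dE; lia.
move: dE U0 E; rewrite cP cU0 /residues !S ua ub => dE U0 E.
have ul : undom l D = undom l (play D v) + 3 by clear -dE; lia.
rewrite ul in E U0; apply: residues_decr3 U0.
by case: E => [|[E4 /(_ l)]]; rewrite ?ul; [left | right].
Qed.

(** If Dominator takes three vertices of an arm and leaves the center fresh, Staller takes a fourth
    there. Less efficient moves, and those spoiling freshness without playing the center, are
    settled by [count_bound]. *)
Lemma fresh_center_bound D : nbhd_union D -> fresh_center D ->
  (forall k, undom k D %% 4 = 0) ->
  undominated D + 1 <= 2 * game_length Dominator D.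
Proof.
have [n] := ubnP #|~: D|; elim: n D => // n IH D; rewrite ltnS => le_n gD fD u4.
have cD : center \notin D by case/andP: fD.
have hD k : vx k 0 \notin D by case/andP: fD => _ /forallP.
have [a [b [_ _ all3 S]]] := three_arms ord0.
have U1 : undominated D %% 4 = 1.
  by rewrite /undominated cD S; have := u4 ord0; have := u4 a; have := u4 b; lia.
have Lc : legal D center by exact: legal_center.
suff H v : legal D v -> (undominated D) %/ 2 <= game_length Staller (play D v).
  by have := dominator_ge Lc H; lia.
move=> Lv; have gv := @nbhd_union_play _ v gD.
case: (vxP v) => [Ev|[l [j [lt_j Ev]]]].
  have [|sB _] := @center_played_bound (play D v) gv.
    by rewrite Ev subsetUr.
  have uE k : undom k D = undom k (play D v) + 1.
    by rewrite Ev undom_play_center hD.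
  have dE : undominated D = undominated (play D v) + 4.
    have cv : center \in play D v by rewrite Ev center_play_center.
    by rewrite /undominated cD cv !S !uE; lia.
  (* Playing the fresh center takes one vertex from each arm, so all three residues become 3. *)
  have r9 : residues (play D v) = 9.
    rewrite /residues S; have := u4 ord0; have := u4 a; have := u4 b.
    by rewrite !uE; lia.
  by rewrite r9 in sB; have := sB _ isT; lia.
have le3 : undominated D <= undominated (play D v) + 3.
  by rewrite Ev; exact: undominated_play_vx.
have [cB _] := count_bound gv.
have {cB} := cB (play_neq0 D v); rewrite /discounted /count_staller => cB.
case fv : (fresh_center (play D v)) cB => cB; last by lia.
have [le2|gt2] := leqP (undominated D) (undominated (play D v) + 2).
  by lia.
have {le3 gt2 cB} dE : undominated D = undominated (play D v) + 3 by lia.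
have [a' [b' [al bl all3' S']]] := three_arms l.
have cDv : center \notin play D v by case/andP: fv.
have ua := undom_play_vx D lt_j al; have ub := undom_play_vx D lt_j bl.
rewrite -Ev in ua ub.
have ul : undom l D = undom l (play D v) + 3.
  by move: dE; rewrite /undominated cD cDv !S' ua ub; clear; lia.
have l_gt0 : 0 < undom l (play D v) by have := u4 l; rewrite ul; clear; lia.
have tw : true \in word l (play D v).
  have jv : vx l j \in play D v by rewrite Ev inE cl_refl orbT.
  by rewrite -[true]jv -nth_word // mem_nth // size_word.
have [i [lt_i uE cE]] := take_one gv tw l_gt0.
set w := vx l i in uE cE.
have Lw : legal (play D v) w.
  by apply/legal_playP => EE; rewrite EE in uE; case: (n_Sn _ uE).
have wa := undom_play_vx (play D v) lt_i al.
have wb := undom_play_vx (play D v) lt_i bl.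
have dE' : undominated (play D v) = undominated (play (play D v) w) + 1.
  by rewrite /undominated cE !S' wa wb uE; clear; lia.
have gw := @nbhd_union_play _ w gv.
apply: leq_trans (staller_ge Lw (leqnn _)).
have [_ cB] := count_bound gw.
(* The fourth vertex may be the neighbour of the center; the discount then no longer applies, and
   [count_bound] suffices. *)
case fw : (fresh_center (play (play D v) w)) cB => cB; last first.
  move: cB; rewrite /discounted fw /count_dominator subn0.
  by clear -dE dE' U1; lia.
have lt_n : #|~: play (play D v) w| < n.
  exact: leq_trans (ltn_trans (card_play Lw) (card_play Lv)) le_n.
have u4' k : undom k (play (play D v) w) %% 4 = 0.
  case/or3P: (all3' k) => /eqP->; rewrite ?wa ?wb ?ua ?ub //.
  by have := u4 l; rewrite ul uE; clear; lia.
by have := IH _ lt_n gw fw u4'; clear -dE dE'; lia.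
Qed.

Lemma gamma_tree_ge : 2 * (p + q + r) + 1 <= gamma_g T.
Proof.
have u0 k : undom k set0 = len k.
  by rewrite /undom word_set0 count_nseq mul1n.
have f0 : fresh_center set0.
  by rewrite /fresh_center inE; apply/forallP => k; rewrite inE.
have g0 : nbhd_union set0 by move=> x; rewrite inE.
have := fresh_center_bound g0 f0; rewrite /undominated inE.
rewrite (eq_bigr len) // sum_len /gamma_g => H.
by have := H (fun k => etrans (congr1 (modn^~ 4) (u0 k)) (len_mod4 p q r k)); lia.
Qed.

End Lower.

Theorem theorem4p1 (p q r : nat) (hp : 1 <= p) (hq : 1 <= q) (hr : 1 <= r) :
  k_gamma_g_critical (2 * (p + q + r) + 1) (tree p q r).
Proof.
have gE : gamma_g (tree p q r) = 2 * (p + q + r) + 1.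
  by apply/eqP; rewrite eqn_leq gamma_tree_le // gamma_tree_ge.
split=> // v; rewrite gE addn1 ltnS.
case: (vxP v) => [->|[l [e [lt_e ->]]]]; first exact: predominated_center.
exact: predominated_vx.
Qed.
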